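(* Let $p\ge1$ be an integer, $\beta\in[0,1)$, $\gamma\in\left[0,\frac{\beta}{1+\beta}\right)$, and let $M>0$ satisfy $(1-\gamma)M>M_{p+1}(f)$. Let $x\in\mathbb{E}$, and let $T\in\mathrm{dom}\,\psi$ and $g\in\partial\psi(T)$ satisfy $$\|\nabla\widehat\Omega_{x,p}(T)+g\|_*\le\frac{\gamma}{1+\gamma}\|\nabla\Omega_{x,p}(T)+g\|_*$$ (that is, $T$ is an approximate solution of the problem $\min_{y\in\mathrm{dom}\,\psi}\{\widehat\Omega_{x,p}(y)+\psi(y)\}$). Then $$\left\|\nabla f(T)+\tfrac{M}{p!}\nabla d_{p+1}(T-x)+g\right\|_*\le\frac{M_{p+1}(f)+\gamma M}{(1-\gamma)M-M_{p+1}(f)}\,\|\nabla f(T)+g\|_*.$$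
   Context: $\mathbb{E}$ is a finite-dimensional real vector space with dual $\mathbb{E}^*$; $B:\mathbb{E}\to\mathbb{E}^*$ is a self-adjoint positive-definite operator, $\|x\|=\langle Bx,x\rangle^{1/2}$ on $\mathbb{E}$ and $\|g\|_*=\langle g,B^{-1}g\rangle^{1/2}$ on $\mathbb{E}^*$. $d_{p+1}(x)=\frac{1}{p+1}\|x\|^{p+1}$, with $\nabla d_{p+1}(x)=\|x\|^{p-1}Bx$. $f:\mathbb{E}\to\mathbb{R}$ is convex and $p+1$ times continuously differentiable, with $M_{p+1}(f)=\sup_{x\in\mathbb{E}}\|D^{p+1}f(x)\|<+\infty$, where $D^kf(x)[h_1,\dots,h_k]$ is the $k$th directional derivative and $\|D^kf(x)\|=\max\{|D^kf(x)[h_1,\dots,h_k]|:\|h_i\|\le1\}$. $D^kf(x)[h]^k$ denotes the value with all directions equal to $h$. $\psi:\mathbb{E}\to\mathbb{R}\cup\{+\infty\}$ is proper closed convex with effective domain $\mathrm{dom}\,\psi$. The Taylor polynomial is $\Omega_{x,p}(y)=f(x)+\sum_{k=1}^p\frac1{k!}D^kf(x)[y-x]^k$ and the augmented Taylor approximation is $\widehat\Omega_{x,p}(y)=\Omega_{x,p}(y)+\frac{M}{(p+1)!}\|y-x\|^{p+1}$; gradients of both are with respect to $y$. *)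

(* Defs.v *)
From HB Require Import structures.
From mathcomp Require Import all_boot all_order all_algebra.
From mathcomp Require Import all_classical all_reals all_analysis.
From mathcomp Require Import ring lra.

Set Implicit Arguments.
Unset Strict Implicit.
Unset Printing Implicit Defensive.

Import Order.TTheory GRing.Theory Num.Theory.
Import numFieldNormedType.Exports.

Local Open Scope classical_set_scope.
Local Open Scope ring_scope.

(* The dual of E is 'Hom(E, R^o); the pairing <g, x> is the application g x. *)
Record spdOp (R : realType) (E : vectType R) := SpdOp {
  spd_op :> 'Hom(E, 'Hom(E, R^o)) ;
  spd_selfadjoint : forall x y : E, spd_op x y = spd_op y x ;
  spd_posdef : forall x : E, x != 0 -> 0 < spd_op x x
}.

Section EuclideanNorm.
Context {R : realType} {E : vectType R} (B : spdOp E).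
Implicit Types x y : E.

Definition spd_norm x : R := Num.sqrt (B x x).

Lemma spd_ge0 x : 0 <= B x x :> R.
Proof.
have [->|/(spd_posdef B)/ltW//] := eqVneq x 0.
by rewrite linear0.
Qed.

Lemma spd_expand (t : R) x y :
  B (x + t *: y) (x + t *: y) = B x x + (t *+ 2) * B x y + t ^+ 2 * B y y :> R.
Proof.
rewrite !linearD !linearZ /= !lfunE /= !lfunE /= !linearD !linearZ /=.
rewrite (spd_selfadjoint B y x) /GRing.scale /=.
ring.
Qed.

Lemma spd_CauchySchwarz x y : (B x y : R) <= spd_norm x * spd_norm y.
Proof.
rewrite -sqrtrM ?spd_ge0//.
have [y0|y0] := eqVneq y 0.
  by rewrite y0 linear0 sqrtr_ge0.
have Byy : 0 < (B y y : R) by exact: spd_posdef.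
have H : (B x y : R) ^+ 2 <= B x x * B y y.
  have := spd_ge0 (x + (- ((B x y : R) / (B y y : R))) *: y).
  rewrite spd_expand -(pmulr_lge0 _ Byy).
  set a : R := B x x; set b : R := B x y; set c : R := B y y.
  have c0 : c != 0 by rewrite gt_eqF.
  have -> : (a + (- (b / c)) *+ 2 * b + (- (b / c)) ^+ 2 * c) * c
            = a * c - b ^+ 2 by field.
  by rewrite subr_ge0.
apply: le_trans (ler_norm _) _.
by rewrite -sqrtr_sqr ler_wsqrtr.
Qed.

Lemma spd_normD x y : spd_norm (x + y) <= spd_norm x + spd_norm y.
Proof.
have nn z : 0 <= spd_norm z by exact: sqrtr_ge0.
rewrite -(@ler_pXn2r _ 2)// ?nnegrE ?addr_ge0//.
rewrite sqr_sqrtr ?spd_ge0// -{1 2}[y]scale1r spd_expand expr1n !mul1r.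
rewrite sqrrD !sqr_sqrtr ?spd_ge0//.
by rewrite lerD2r lerD2l mulr_natl lerMn2r spd_CauchySchwarz orbT.
Qed.

Lemma spd_normZ (t : R) x : spd_norm (t *: x) = `|t| * spd_norm x.
Proof.
rewrite /spd_norm !linearZ /= lfunE /= linearZ /= /GRing.scale /= mulrA -expr2.
by rewrite sqrtrM ?sqr_ge0// sqrtr_sqr.
Qed.

Lemma spd_norm0_eq0 x : spd_norm x = 0 -> x = 0.
Proof.
move=> nx0; apply/eqP; apply: contraT => /(spd_posdef B).
by rewrite -sqrtr_gt0 -/(spd_norm x) nx0 ltxx.
Qed.

End EuclideanNorm.

(* The space E normed by `|x| = <B x, x>^(1/2). *)
Definition euclid {R : realType} {E : vectType R} (B : spdOp E) : Type := E.

HB.instance Definition _ (R : realType) (E : vectType R) (B : spdOp E) :=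
  Vector.on (euclid B).
HB.instance Definition _ (R : realType) (E : vectType R) (B : spdOp E) :=
  @Lmodule_isNormed.Build R (euclid B) (spd_norm B)
    (spd_normD B) (spd_normZ B) (@spd_norm0_eq0 _ _ B).

Section Definitions.
Context {R : realType} {E : vectType R} (B : spdOp E).
Notation V := (euclid B).
Notation V' := 'Hom(euclid B, R^o).
Implicit Types (f F : V -> R) (psi : V -> \bar R) (g : V').

(* ||g||_* = <g, B^-1 g>^(1/2); B is bijective, so (B^-1)%VF is its inverse. *)
Definition dual_norm g : R := Num.sqrt (g ((B^-1)%VF g)).

(* The gradient as an element of the dual: <grad F x, h> = DF(x)[h]. *)
Definition grad F (x : V) : V' := linfun (fun h : V => 'D_h F x : R^o).

(* D^k f(x)[h_1, ..., h_k] for hs = [:: h_1; ...; h_k]. *)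
Fixpoint dirD f (hs : seq V) : V -> R :=
  if hs is h :: hs' then dirD ('D_h f) hs' else f.

(* In finite dimension, Df : V -> V' is of class C^k iff all its components
   x |-> Df(x)[h] are. *)
Fixpoint Ck (k : nat) f : Prop :=
  if k is k'.+1 then
    (forall x, differentiable f x) /\ forall h : V, Ck k' ('D_h f)
  else continuous f.

Definition normD (k : nat) f (x : V) : \bar R :=
  ereal_sup [set (`|dirD f hs x|)%:E |
             hs in [set hs : k.-tuple V | forall i, `|tnth hs i| <= 1]].

Definition supD (k : nat) f : \bar R := ereal_sup (range (normD k f)).

Definition dpow (q : nat) (x : V) : R := q%:R^-1 * `|x| ^+ q.

Definition taylor f (x : V) (p : nat) (y : V) : R :=
  f x + \sum_(1 <= k < p.+1) k`!%:R^-1 * dirD f (nseq k (y - x)) x.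

Definition aug_taylor (M : R) f (x : V) (p : nat) (y : V) : R :=
  taylor f x p y + M / p.+1`!%:R * `|y - x| ^+ p.+1.

Definition dom psi : set V := [set x | (psi x < +oo)%E].

Definition epigraph psi : set (V * R^o) := [set z | (psi z.1 <= z.2%:E)%E].

Definition proper_closed_convex psi : Prop :=
  [/\ forall x, psi x != -oo%E, dom psi !=set0,
      closed (epigraph psi) & convex_set (epigraph psi)].

Definition subdifferential psi (x : V) : set V' :=
  [set g | forall y, (psi x + (g (y - x))%:E <= psi y)%E].

End Definitions.

(* Main.v *)
Require Import Defs.
From HB Require Import structures.
From mathcomp Require Import all_boot all_order all_algebra.
From mathcomp Require Import all_classical all_reals all_analysis.
From mathcomp Require Import ring lra.

Import Order.TTheory GRing.Theory Num.Theory.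
Import numFieldNormedType.Exports.

Local Open Scope classical_set_scope.
Local Open Scope ring_scope.

(** Write [n] for the gradient at [T] of the regularizing term, [D] for the gradient of the Taylor
    polynomial plus [g], and [A] for the gradient of [f] plus [g]. The gradient of the
    augmented model plus [g] is [D + n], and the claim compares [A + n] with [A]. With [r] the
    norm of [T - x] and [L] the supremum of the norm of the derivative of order [p + 1], the
    dual norm of [n] is exactly [M / p! * r ^ p] ([grad_dpow], [dual_norm_grad_dpow]), and that
    of [A - D] is at most [L / p! * r ^ p] ([dual_norm_grad_taylor_error]). Everything else is
    the triangle inequality: [inexact_step_arith].

    The Taylor error is treated one direction [h] at a time. The derivative of the Taylor
    polynomial in the direction [h] is the Taylor polynomial of degree [p - 1] of ['D_h f]
    ([is_derive_taylor]), so the error is a one-variable Taylor remainder of ['D_h f] on the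
    segment from [x] to [T] ([taylor_remainder_le]). Differentiating the homogeneous parts
    [y |-> D^k f(x)[y - x]^k] requires [h] to be moved to the front of the list of
    directions, hence the symmetry of second derivatives ([derive_comm]).

    Gradients are built from directional derivatives, so it suffices to know that these
    exist and depend linearly on the direction. *)

(** * Directional derivatives along lines *)

Section DirectionalDerivatives.
Context {R : realType} {V : normedModType R}.
Implicit Types (F : V -> R) (x u h : V).

Lemma is_derive_lineE F x u (t d : R) :
  is_derive (x + t *: u) u F d <-> is_derive t (1 : R) (fun s : R => F (x + s *: u)) d.
Proof.
pose l (s : R) := F (x + s *: u).
have quotE : (fun k : R => k^-1 *: ((F \o shift (x + t *: u)) (k *: u) - l t))
           = (fun k : R => k^-1 *: ((l \o shift t) (k *: (1 : R)) - l t)).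
  apply/funext => k /=; congr (_ *: (F _ - _)).
  by rewrite scalerDl addrCA /GRing.scale /= mulr1.
by split=> -[cv lv]; (split; [move: cv|move: lv]); rewrite /derivable /derive quotE.
Qed.

Lemma is_derive_along_line F x u : (forall y, derivable F y u) ->
  forall t, is_derive t (1 : R) (fun s : R => F (x + s *: u)) ('D_u F (x + t *: u)).
Proof. by move=> dF t; apply/is_derive_lineE/derivableP. Qed.

Lemma is_derive_line0E F u h (d : R) :
  is_derive u h F d <-> is_derive (0 : R) (1 : R) (fun s : R => F (u + s *: h)) d.
Proof.
by rewrite -[X in is_derive X](addr0 u) -{1}(scale0r h); exact: is_derive_lineE.
Qed.

Lemma is_derive_translate F u h x (d : R) :
  is_derive (u - x) h F d -> is_derive u h (fun y => F (y - x)) d.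
Proof.
move=> /is_derive_line0E dF; apply/is_derive_line0E; move: dF.
by congr (is_derive _ _ _ _); apply/funext => s; rewrite addrAC.
Qed.

Lemma derive_dir_addZ F x (c : R) u h : differentiable F x ->
  'D_(u + c *: h) F x = 'D_u F x + c * 'D_h F x.
Proof. by move=> dF; rewrite !deriveE// linearD linearZ. Qed.

Lemma is_derive_sum_ord {W : normedModType R} n (h : 'I_n -> W -> R) (dh : 'I_n -> R)
    (x v : W) :
  (forall i, is_derive x v (h i) (dh i)) ->
  is_derive x v (fun y => \sum_(i < n) h i y) (\sum_(i < n) dh i).
Proof.
move=> H; have := @is_derive_sum _ _ _ n h x v dh H.
rewrite (_ : \sum_(i < n) h i = fun y => \sum_(i < n) h i y)//.
by apply/funext => y; rewrite fct_sumE.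
Qed.

(** [s * G s] has the difference quotient [G s] at 0, so continuity of [G] is enough. *)
Lemma is_derive_mul_id (G : R -> R) : {for 0, continuous G} ->
  is_derive (0 : R) (1 : R) (fun s => s * G s) (G 0).
Proof.
move=> cG.
have cvgG : (fun s : R => s^-1 *: (((fun r => r * G r) \o shift 0) (s *: (1 : R))
    - 0 * G 0)) @ 0^' --> G 0.
  apply: cvg_trans (cvg_within_filter _ cG).
  apply: near_eq_cvg; near=> s.
  have s0 : s != 0 by near: s; exact: nbhs_dnbhs_neq.
  by rewrite /= /GRing.scale /= mulr1 addr0 mul0r subr0 mulKf.
split; first by apply/cvg_ex; exists (G 0).
exact/cvg_lim.
Unshelve. all: by end_near. Qed.

End DirectionalDerivatives.

(** * One-variable Taylor inequality *)

Section OneVariable.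
Context {R : realType}.

Lemma MVT_total (F dF : R -> R) (a b : R) : a < b ->
  (forall t, is_derive t (1 : R) F (dF t)) ->
  exists2 c, a < c < b & F b - F a = dF c * (b - a).
Proof.
move=> ab dFP.
have [c cab ->] := @MVT R F dF a b ab (fun t _ => dFP t)
  (@derivable_within_continuous _ _ F `[a, b]
    (fun t _ => @ex_derive _ _ _ _ _ _ _ (dFP t))).
by exists c => //; move: cab; rewrite in_itv.
Qed.

(** Both [H + G] and [H - G] vanish at 0 and have a nonnegative derivative. *)
Lemma abs_le_of_derive_abs_le (G H dG dH : R -> R) :
  (forall t, is_derive t (1 : R) G (dG t)) ->
  (forall t, is_derive t (1 : R) H (dH t)) ->
  G 0 = 0 -> H 0 = 0 ->
  (forall t, 0 <= t <= 1 -> `|dG t| <= dH t) ->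
  forall t, 0 <= t <= 1 -> `|G t| <= H t.
Proof.
move=> GP HP G0 H0 le_d t /andP[]; rewrite le_eqVlt => /predU1P[<- _|t0 t1].
  by rewrite G0 H0 normr0.
have nonneg_at_t (D : R -> R) (dD : R -> R) : (forall s, is_derive s (1 : R) D (dD s)) ->
    D 0 = 0 -> (forall s, 0 <= s <= 1 -> 0 <= dD s) -> 0 <= D t.
  move=> DP D0 dD0; have [c /andP[c0 ct]] := MVT_total _ _ _ _ t0 DP.
  rewrite D0 !subr0 => ->; rewrite mulr_ge0 ?(ltW t0)// dD0//.
  by rewrite (ltW c0) (le_trans (ltW ct)).
have sum_ge0 : 0 <= H t + G t.
  apply: (nonneg_at_t (H + G) (fun s => dH s + dG s)
    (fun s => is_deriveD (HP s) (GP s))) => [|s s01].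
  - by rewrite -[LHS]/(H 0 + G 0) H0 G0 addr0.
  - by have := le_d s s01; rewrite ler_norml => /andP[] ? _; lra.
have sub_ge0 : 0 <= H t - G t.
  apply: (nonneg_at_t (H - G) (fun s => dH s - dG s)
    (fun s => is_deriveB (HP s) (GP s))) => [|s s01].
  - by rewrite -[LHS]/(H 0 - G 0) H0 G0 subr0.
  - by have := le_d s s01; rewrite ler_norml => /andP[] _ ?; lra.
by rewrite ler_norml; lra.
Qed.

Lemma is_derive_monomial (c : R) n (t : R) :
  is_derive t (1 : R) (fun s => c / n.+1`!%:R * s ^+ n.+1) (c / n`!%:R * t ^+ n).
Proof.
have := is_deriveZ (c / n.+1`!%:R) (is_deriveX n.+1 (is_derive_id t (1 : R))).
rewrite (_ : _ \*: _ = fun s => c / n.+1`!%:R * s ^+ n.+1).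
  move=> dP; apply: is_derive_eq.
  rewrite /GRing.scale /= mulr1 factS natrM invfM.
  have : n.+1%:R != 0 :> R by rewrite pnatr_eq0.
  by move: n.+1%:R n`!%:R^-1 => a b a0; field.
apply/funext => s /=; rewrite /GRing.scale /=; congr (_ * _).
by elim: n.+1 => [|m IH]//; rewrite !exprS -IH.
Qed.

(** Iterating the comparison of derivatives: the Taylor remainder of [phi 0] of order
    [n.+1] has as derivative the remainder of [phi 1] of order [n]. The derivatives are given
    as a sequence so that the induction is a shift of indices. *)
Lemma taylor_remainder_le (K : R) n : forall (phi : nat -> R -> R),
  (forall j t, (j < n)%N -> is_derive t (1 : R) (phi j) (phi j.+1 t)) ->
  (forall t, 0 <= t <= 1 -> `|phi n t| <= K) ->
  forall t, 0 <= t <= 1 ->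
  `|phi 0 t - \sum_(j < n) phi j 0 / j`!%:R * t ^+ j| <= K / n`!%:R * t ^+ n.
Proof.
elim: n => [|n IH] phi dphi Kphi t t01.
  by rewrite big_ord0 subr0 fact0 divr1 expr0 mulr1 Kphi.
apply: (abs_le_of_derive_abs_le
    (fun t => phi 0 t - \sum_(j < n.+1) phi j 0 / j`!%:R * t ^+ j)
    (fun t => K / n.+1`!%:R * t ^+ n.+1)
    (fun t => phi 1 t - \sum_(j < n) phi j.+1 0 / j`!%:R * t ^+ j)
    (fun t => K / n`!%:R * t ^+ n) _ _ _ _ _ t t01).
- move=> s; rewrite (_ : (fun _ => _) = (phi 0 - cst (phi 0 0))
     - (fun t => \sum_(j < n) phi j.+1 0 / j.+1`!%:R * t ^+ j.+1)); last first.
    by apply/funext => r; rewrite big_ord_recl /= fact0 expr0 divr1 mulr1 opprD addrA.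
  apply: is_deriveB; last by apply: is_derive_sum_ord => i; apply: is_derive_monomial.
  by rewrite -[phi 1 s]subr0; apply: is_deriveB; first exact: dphi.
- by move=> s; apply: is_derive_monomial.
- rewrite big_ord_recl fact0 expr0 divr1 mulr1 big1 ?addr0 ?subrr// => i _.
  by rewrite expr0n mulr0.
- by rewrite expr0n mulr0.
- by apply: (IH (fun j => phi j.+1)) => // j s jn; apply: dphi.
Qed.

End OneVariable.

(** * Symmetry of second directional derivatives *)

Section Symmetry.
Context {R : realType} {V : normedModType R}.
Implicit Types (F : V -> R) (x u v : V).

(** The mean value theorem in the direction [u], applied to the increment of [F] by
    [s *: v], and then in the direction [v]. *)
Lemma second_difference F x u v (s : R) : 0 < s ->
  (forall y, derivable F y u) -> (forall y, derivable ('D_u F) y v) ->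
  exists2 ab : R * R, (0 < ab.1 < s) && (0 < ab.2 < s) &
  F (x + s *: u + s *: v) - F (x + s *: u) - F (x + s *: v) + F x
    = 'D_v ('D_u F) (x + ab.1 *: u + ab.2 *: v) * s ^+ 2.
Proof.
move=> s0 dF ddF.
pose G := (fun r : R => F (x + s *: v + r *: u)) - (fun r : R => F (x + r *: u)).
have [a as0 Ga] := MVT_total G
  (fun r => 'D_u F (x + s *: v + r *: u) - 'D_u F (x + r *: u)) _ _ s0
  (fun r => is_deriveB (is_derive_along_line _ (x + s *: v) _ dF r)
    (is_derive_along_line _ _ _ dF r)).
have [b bs0 Gb] := MVT_total _ _ _ _ s0 (is_derive_along_line _ (x + a *: u) _ ddF).
exists (a, b) => /=; first by rewrite as0.
have GE r : G r = F (x + s *: v + r *: u) - F (x + r *: u) by [].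
move: Ga Gb; rewrite !GE !scale0r !addr0 subr0.
rewrite ![x + s *: v + _]addrAC => Ga Gb.
rewrite expr2 mulrA -Gb -Ga; lra.
Qed.

(** The second difference of [F] is symmetric in [u] and [v] while [second_difference]
    expresses it by either mixed derivative, at two points that tend to [x] with [s]. *)
Lemma derive_comm F u v x :
  (forall y, derivable F y u) -> (forall y, derivable F y v) ->
  (forall y, derivable ('D_u F) y v) -> (forall y, derivable ('D_v F) y u) ->
  {for x, continuous ('D_v ('D_u F))} -> {for x, continuous ('D_u ('D_v F))} ->
  'D_v ('D_u F) x = 'D_u ('D_v F) x.
Proof.
move=> du dv duv dvu cuv cvu; apply/eqP; rewrite -subr_eq0 -normr_eq0.
apply/negPn/negP => n0.
set A := 'D_v ('D_u F) x in n0 *; set A' := 'D_u ('D_v F) x in n0 *.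
have e0 : 0 < `|A - A'| / 2 by rewrite divr_gt0// lt_neqAle eq_sym n0/=.
move/cvgrPdist_lt : cuv => /(_ _ e0)/nbhs_ballP[d1 /= d10 H1].
move/cvgrPdist_lt : cvu => /(_ _ e0)/nbhs_ballP[d2 /= d20 H2].
set d := Num.min d1 d2; have d0 : 0 < d by rewrite lt_min d10.
(* The + 1 keeps the denominator positive when both directions vanish. *)
have N0 : 0 < `|u| + `|v| + 1 by rewrite ltr_wpDl// addr_ge0.
pose s := d / (`|u| + `|v| + 1); have s0 : 0 < s by rewrite divr_gt0.
have near_x (a b : R) : (0 < a < s) && (0 < b < s) -> ball x d (x + a *: u + b *: v).
  move=> /andP[/andP[a0 as_] /andP[b0 bs]].
  rewrite -ball_normE /= -addrA opprD addNKr normrN.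
  rewrite (le_lt_trans (ler_normD _ _))// !normrZ !gtr0_norm//.
  apply: (@le_lt_trans _ _ (s * (`|u| + `|v|))).
    by rewrite mulrDr lerD// ler_wpM2r// ltW.
  rewrite -[ltRHS](@divfK _ (`|u| + `|v| + 1)) ?gt_eqF// -/s ltr_pM2l//.
  by rewrite ltrDl.
have [[a b] abs E1] := second_difference F x u v s s0 du duv.
have [[b' a'] abs' E2] := second_difference F x v u s s0 dv dvu.
have EA : 'D_v ('D_u F) (x + a *: u + b *: v) = 'D_u ('D_v F) (x + b' *: v + a' *: u).
  apply: (@mulIf _ (s ^+ 2)); first by rewrite expf_neq0 ?gt_eqF.
  apply: etrans (esym E1) _; apply: etrans _ E2; rewrite (addrAC x (s *: v)).
  by move: (F _) (F _) (F _) (F _) => ? ? ? ?; ring.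
have {H1} : `|A - 'D_v ('D_u F) (x + a *: u + b *: v)| < `|A - A'| / 2.
  apply: H1; apply: (@le_ball _ _ _ d); first by rewrite ge_min lexx.
  exact: near_x abs.
have {H2} : `|A' - 'D_u ('D_v F) (x + b' *: v + a' *: u)| < `|A - A'| / 2.
  apply: H2; apply: (@le_ball _ _ _ d); first by rewrite ge_min lexx orbT.
  by rewrite addrAC; apply: near_x; rewrite andbC.
rewrite EA; move: ('D_u ('D_v F) _) => C.
clearbody A A' => A'C AC.
have := ler_distD C A A'; rewrite (distrC C A') => tri.
by have := le_lt_trans tri (ltrD AC A'C); rewrite -splitr ltxx.
Qed.
End Symmetry.

(** * The dual norm *)

Section Euclid.
Context {R : realType} {E : vectType R} {B : spdOp E}.
Notation V := (euclid B).
Notation V' := 'Hom(euclid B, R^o).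
Implicit Types (F G : V -> R) (x u h : V) (g : V').

(** Definiteness makes [B] injective, and [E] and its dual have the same dimension. *)
Lemma spd_invK : cancel (B^-1)%VF B.
Proof.
have Bker : lker B == 0%VS.
  apply/lker0P => y z Byz; apply/eqP; rewrite -subr_eq0; apply: contraT => /(spd_posdef B).
  have -> : B (y - z) = 0 by rewrite linearB; apply/eqP; rewrite subr_eq0; apply/eqP.
  by rewrite zero_lfunE ltxx.
have Bimg : limg B = fullv.
  apply/eqP; rewrite eqEdim subvf limg_dim_eq; last by apply/eqP; rewrite (eqP Bker) capv0.
  by rewrite !dimvf /dim /= muln1.
by move=> g; rewrite limg_lfunVK// Bimg memvf.
Qed.

(** [B^-1] is an isometry from the dual onto the Euclidean space, so the dual norm inherits
    the norm axioms. *)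
Lemma dual_normE g : dual_norm g = `|(B^-1)%VF g : V|.
Proof. by rewrite /dual_norm -{1}(spd_invK g). Qed.

Lemma dual_normD g g' : dual_norm (g + g') <= dual_norm g + dual_norm g'.
Proof. by rewrite !dual_normE linearD ler_normD. Qed.

Lemma dual_normZ (c : R) g : dual_norm (c *: g) = `|c| * dual_norm g.
Proof. by rewrite !dual_normE linearZ /= normrZ. Qed.

Lemma dual_norm_le_addr g g' : dual_norm g <= dual_norm (g + g') + dual_norm g'.
Proof.
have <- : dual_norm (- g') = dual_norm g'.
  by rewrite -scaleN1r dual_normZ normrN1 mul1r.
by rewrite -{1}(addrK g' g) dual_normD.
Qed.

Lemma dual_norm_spd x : dual_norm (B x : V') = `|x|.
Proof. by rewrite /dual_norm -(spd_selfadjoint B) spd_invK. Qed.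

(** The value of [g] at [B^-1 g] is the square of its dual norm, so that vector is the only one
    that has to be tested. *)
Lemma dual_norm_le g (K : R) : 0 <= K ->
  (forall h, g h <= K * `|h|) -> dual_norm g <= K.
Proof.
move=> K0 gK; have := gK ((B^-1)%VF g); rewrite -dual_normE.
have <- : dual_norm g ^+ 2 = g ((B^-1)%VF g).
  by rewrite sqr_sqrtr//; have := spd_ge0 B ((B^-1)%VF g); rewrite spd_invK.
rewrite expr2; have : 0 <= dual_norm g by exact: sqrtr_ge0.
by rewrite le_eqVlt => /predU1P[<- _|d0]//; rewrite ler_pM2r.
Qed.

Lemma norm_sqr x : `|x| ^+ 2 = B x x.
Proof. by rewrite sqr_sqrtr// spd_ge0. Qed.

(** * Multilinearity of the higher derivatives *)

Lemma CkS k F : Ck k.+1 F -> Ck k F.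
Proof.
elim: k F => [|k IH] F /= [dF DF]; first by move=> x; apply: differentiable_continuous.
by split => // h; apply: IH.
Qed.

Lemma Ck_le k m F : (k <= m)%N -> Ck m F -> Ck k F.
Proof. by move/subnK <-; elim: (m - k)%N => [|n IH]//; rewrite addSn => /CkS/IH. Qed.

Lemma Ck_derivable {k F} x h : Ck k.+1 F -> derivable F x h.
Proof. by move=> [dF _]; exact: diff_derivable. Qed.

Lemma Ck_dirD k F hs : Ck (size hs + k) F -> Ck k (dirD F hs).
Proof. by elim: hs F => [|h hs IH] F //= [_ /(_ h)/IH]. Qed.

Lemma dirD_rcons F hs h : dirD F (rcons hs h) = 'D_h (dirD F hs).
Proof. by elim: hs F => [|k hs IH] F /=. Qed.

Lemma Ck_derive_comm F u h : Ck 2 F -> 'D_h ('D_u F) = 'D_u ('D_h F).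
Proof.
move=> C2; apply/funext => x; have [dF DF] := C2; apply: derive_comm.
- by move=> y; exact: (@Ck_derivable 1 _ _ _ C2).
- by move=> y; exact: (@Ck_derivable 1 _ _ _ C2).
- by move=> y; exact: (@Ck_derivable 0 _ _ _ (DF u)).
- by move=> y; exact: (@Ck_derivable 0 _ _ _ (DF h)).
- by have [_ /(_ h)] := DF u; apply.
- by have [_ /(_ u)] := DF h; apply.
Qed.

Lemma dirD_addZ F G (c : R) hs : Ck (size hs) F -> Ck (size hs) G ->
  dirD (fun y => F y + c * G y) hs = fun y => dirD F hs y + c * dirD G hs y.
Proof.
elim: hs F G => [|h hs IH] F G //= CF CG.
rewrite -IH; [|by case: CF|by case: CG].
congr (dirD _ hs); apply/funext => y.
have dF := derivableP (Ck_derivable y h CF).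
have dG := derivableP (Ck_derivable y h CG).
by have [] := is_deriveD dF (is_deriveZ c dG).
Qed.

(** The first direction is the one whose derivative is taken first; a repeated direction is
    then expanded one entry at a time, by recursion on the list. *)
Lemma dirD_head_addZ F (c : R) u h hs x : Ck (size hs).+1 F ->
  dirD F ((u + c *: h) :: hs) x = dirD F (u :: hs) x + c * dirD F (h :: hs) x.
Proof.
move=> [dF DF] /=; rewrite (_ : 'D_(u + c *: h) F = fun y => 'D_u F y + c * 'D_h F y).
  by rewrite dirD_addZ; [|exact: DF|exact: DF].
by apply/funext => y; rewrite derive_dir_addZ.
Qed.

Lemma dirD_headZ F (c : R) h hs x : Ck (size hs).+1 F ->
  dirD F (c *: h :: hs) x = c * dirD F (h :: hs) x.
Proof.
move=> CF; have := dirD_head_addZ F (c - 1) h h hs x CF.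
rewrite -{1}[h]scale1r -scalerDl addrC subrK => ->.
by rewrite mulrBl mul1r addrC subrK.
Qed.

Lemma dirD_nseqZ F (c : R) u k x : Ck k F ->
  dirD F (nseq k (c *: u)) x = c ^+ k * dirD F (nseq k u) x.
Proof.
elim: k F x => [|k IH] F x CF; first by rewrite expr0 mul1r.
have CF' : Ck (size (nseq k (c *: u))).+1 F by rewrite size_nseq.
rewrite [nseq _ _]/= dirD_headZ//= IH; last by case: CF => _; apply.
by rewrite mulrA exprS.
Qed.

(** * Gradients of the Taylor polynomial and of powers of the norm *)

(** [linfun f] has the values of [f] only when [f] is linear; this form takes the linearity
    as a hypothesis, as ['D_h F x] need not be linear in [h] unless [F] is differentiable at [x]. *)
Lemma linfun_linearE {W : vectType R} (f : W -> R^o) : linear f -> linfun f =1 f.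
Proof.
move=> lf.
pose L := GRing.isLinear.Build R W R^o _ f lf.
pose f' : {linear W -> R^o} := HB.pack f L.
exact: (lfunE f').
Qed.

Lemma grad_eq F x g : (forall h, is_derive x h F (g h)) -> grad F x = g.
Proof.
move=> dF; rewrite -[RHS]fun_of_lfunK; congr linfun; apply/funext => h.
by have [] := dF h.
Qed.

Lemma gradE F x h : differentiable F x -> grad F x h = 'D_h F x.
Proof.
move=> dF; rewrite /grad linfun_linearE// => c u v.
by rewrite !deriveE// linearP.
Qed.

(** Product rule by induction on the degree: the first direction splits off by linearity, and
    symmetry of the second derivative makes the terms where [h] replaces the first or a later
    [u] equal. At [k = 0] the coefficient vanishes, whatever the predecessor. *)
Lemma is_derive_dirD_nseq F k x u h : Ck k F ->
  is_derive u h (fun y => dirD F (nseq k y) x)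
    (k%:R * dirD ('D_h F) (nseq k.-1 u) x).
Proof.
elim: k F => [|k IH] F CF; first by rewrite mul0r; exact: is_derive_cst.
have [dF DF] := CF.
have swap : k%:R * dirD ('D_h ('D_u F)) (nseq k.-1 u) x
            = k%:R * dirD ('D_h F) (nseq k u) x.
  case: k CF {IH DF} => [|k] CF; first by rewrite !mul0r.
  have C2 : Ck 2 F := @Ck_le 2 k.+2 F isT CF.
  by rewrite [k.+1.-1]/= (Ck_derive_comm F u h C2).
apply/is_derive_line0E.
have -> : (fun s : R => dirD F (nseq k.+1 (u + s *: h)) x)
    = (fun s : R => dirD ('D_u F) (nseq k (u + s *: h)) x)
    + (id : R -> R) * (fun s : R => dirD ('D_h F) (nseq k (u + s *: h)) x).
  by apply/funext => s; apply: dirD_head_addZ; rewrite size_nseq.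
have /is_derive_line0E du := IH _ (DF u).
have /is_derive_line0E dh := IH _ (DF h).
have dP := is_deriveD du (is_deriveM (is_derive_id (0 : R) (1 : R)) dh).
apply: (is_derive_eq dP).
have combine (a a' b s w : R) : k%:R * a = k%:R * w -> s = 0 -> a' = w ->
    k%:R * a + (s *: b + a' *: (1 : R)) = k.+1%:R * w.
  move=> -> -> ->.
  by rewrite /GRing.scale /= mul0r add0r mulr1 -natr1 mulrDl mul1r.
apply: combine; [exact: swap|by []|].
by congr (dirD _ (nseq k _) x); rewrite scale0r addr0.
Qed.

(** The derivative of the Taylor polynomial of [F] is the Taylor polynomial, of one degree
    less, of the derivative: the factor [j.+1] coming from the homogeneous part of degree
    [j.+1] cancels against the factorial. *)
Lemma is_derive_taylor F p x y h : Ck p F ->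
  is_derive y h (taylor F x p)
    (\sum_(j < p) dirD ('D_h F) (nseq j (y - x)) x / j`!%:R).
Proof.
move=> CF.
rewrite (_ : taylor F x p = cst (F x) + fun z => \sum_(j < p)
    (j.+1`!%:R^-1 \*: (fun z => dirD F (nseq j.+1 (z - x)) x)) z); last first.
  by apply/funext => z; rewrite /taylor big_add1 big_mkord.
rewrite -[X in is_derive _ _ _ X]add0r; apply: is_deriveD; apply: is_derive_sum_ord => j.
have CjF : Ck j.+1 F by apply: Ck_le CF.
have dP := is_deriveZ (j.+1`!%:R^-1)
  (is_derive_translate _ _ _ x _ (is_derive_dirD_nseq F j.+1 x (y - x) h CjF)).
apply: is_derive_eq.
rewrite -[_ *: _]/(_ * _) mulrC factS natrM invfM.
have : j.+1%:R != 0 :> R by rewrite pnatr_eq0.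
by rewrite /=; move: (dirD _ _ _) j.+1%:R j`!%:R^-1 => d a b a0; field.
Qed.

Lemma is_derive_norm u h : u != 0 ->
  is_derive u h (fun y : V => `|y|) (B u h / `|u| : R).
Proof.
move=> u0; apply/is_derive_line0E.
pose q := (fun s : R => B u u + (s *+ 2) * B u h + s ^+ 2 * B h h : R).
have qE (s : R) : B (u + s *: h) (u + s *: h) = q s by rewrite spd_expand.
rewrite (_ : (fun s : R => _) = Num.sqrt \o q); last by apply/funext => s; rewrite /= -qE.
have dq : is_derive (0 : R) (1 : R) q (B u h *+ 2).
  pose P : {poly R} := (B u u)%:P + ((B u h *+ 2) *: 'X + (B h h : R) *: 'X^2).
  rewrite (_ : q = horner P); last first.
    apply/funext => s.
    by rewrite /q /P !(hornerD, hornerZ, hornerC, hornerX, hornerXn); ring.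
  apply: is_derive_eq; rewrite /P !(derivD, derivZ, derivC, derivX, derivXn).
  rewrite !(hornerD, hornerZ, hornerC, hornerX, hornerXn, hornerMn, horner0).
  by rewrite expr0n /=; ring.
have q0 : q 0 = `|u| ^+ 2 by rewrite norm_sqr /q; ring.
have q0_gt0 : 0 < q 0 by rewrite q0 exprn_gt0 ?normr_gt0.
have := is_derive1_comp (is_derive1_sqrt q0_gt0) dq.
move=> dP; apply: is_derive_eq.
rewrite q0 sqrtr_sqr normr_id.
have : `|u| != 0 by rewrite normr_eq0.
by move: `|u| (B u h) => n b n0; field.
Qed.

(** At [u = 0] the norm is not differentiable, but its powers of exponent at least 2 are: along
    the line of direction [h] they are [s * (s * `|s| ^+ q * `|h| ^+ q.+2)]. *)
Lemma is_derive_norm_exp q u h :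
  is_derive u h (fun y : V => `|y| ^+ q.+2) (q.+2%:R * (`|u| ^+ q * B u h)).
Proof.
have [->|u0] := eqVneq u 0.
  rewrite linear0 zero_lfunE !mulr0; apply/is_derive_line0E.
  rewrite (_ : (fun s : R => _)
    = fun s : R => s * (s * `|s| ^+ q * `|h| ^+ q.+2)); last first.
    apply/funext => s; rewrite add0r normrZ exprMn 2!exprS !mulrA -expr2.
    by rewrite real_normK ?num_real// expr2.
  rewrite [X in is_derive _ _ _ X](_ : _
    = (fun s : R => s * `|s| ^+ q * `|h| ^+ q.+2) 0).
    apply: is_derive_mul_id; apply: cvgM; last exact: cvg_cst.
    apply: cvgM; first exact: cvg_id.
    apply: (@continuous_comp _ _ _ (fun s : R => `|s|) (fun s : R => s ^+ q)).
      exact: norm_continuous.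
    exact: exprn_continuous.
  by rewrite /= !mul0r.
rewrite (_ : (fun _ => _) = (fun y : V => `|y|) ^+ q.+2); last first.
  by apply/funext => y; rewrite exprfctE.
have dP := is_deriveX q.+2 (is_derive_norm _ h u0).
apply: is_derive_eq; rewrite /GRing.scale /= exprS.
have : `|u| != 0 by rewrite normr_eq0.
by move: `|u| (B u h) (_ ^+ _) => n b c n0; field.
Qed.

Lemma grad_dpow q u : grad (dpow q.+2) u = `|u| ^+ q *: B u :> V'.
Proof.
apply: grad_eq => h; rewrite scale_lfunE.
have dP := is_deriveZ (q.+2%:R^-1) (is_derive_norm_exp q u h).
apply: (is_derive_eq dP).
by rewrite /GRing.scale /= mulKf ?pnatr_eq0.
Qed.

Lemma grad_taylorE F p x y h : Ck p F ->
  grad (taylor F x p) y h = \sum_(j < p) dirD ('D_h F) (nseq j (y - x)) x / j`!%:R.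
Proof.
move=> CF; rewrite /grad linfun_linearE; first by have [] := is_derive_taylor F p x y h CF.
move=> c u v.
have D w : 'D_w (taylor F x p) y = \sum_(j < p) dirD ('D_w F) (nseq j (y - x)) x / j`!%:R.
  by have [] := is_derive_taylor F p x y w CF.
rewrite !D /GRing.scale /= mulr_sumr -big_split /=; apply: eq_bigr => j _.
have CjF : Ck (size (nseq j (y - x))).+1 F by rewrite size_nseq; exact: Ck_le CF.
have := dirD_head_addZ F c v u _ x CjF; rewrite [c *: u + v]addrC /= => ->.
by rewrite mulrDl mulrA addrC.
Qed.

Lemma grad_aug_taylor F p M x y : Ck p.+1 F ->
  grad (aug_taylor M F x p.+1) y
  = grad (taylor F x p.+1) y + (M / p.+1`!%:R) *: grad (dpow p.+2) (y - x).
Proof.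
move=> CF; apply: grad_eq => h.
rewrite add_lfunE grad_taylorE// grad_dpow !scale_lfunE.
have dT := is_derive_taylor F p.+1 x y h CF.
have dN := is_derive_translate _ _ _ x _ (is_derive_norm_exp p (y - x) h).
have dP := is_deriveD dT (is_deriveZ (M / p.+2`!%:R) dN).
apply: (is_derive_eq dP); congr (_ + _); rewrite /GRing.scale /= factS natrM invfM.
have : p.+2%:R != 0 :> R by rewrite pnatr_eq0.
by move: (_ * B _ _) p.+2%:R p.+1`!%:R^-1 => d a b a0; field.
Qed.

Lemma dual_norm_grad_dpow q u : dual_norm (grad (dpow q.+2) u) = `|u| ^+ q.+1.
Proof. by rewrite grad_dpow dual_normZ dual_norm_spd normrX normr_id exprSr. Qed.

(** * Bounding the Taylor error of the gradient *)

Lemma dirD_le_supD k F hs x : size hs = k -> (supD k F < +oo)%E ->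
  (forall h, h \in hs -> `|h| <= 1) -> `|dirD F hs x| <= fine (supD k F).
Proof.
move=> /eqP szhs sfin hs1.
have le_sup : (`|dirD F hs x|%:E <= supD k F)%E.
  apply: (@le_trans _ _ (normD k F x)).
    apply: ereal_sup_ubound; exists (Tuple szhs) => //= i.
    by apply: hs1; rewrite -[hs]/(tval (Tuple szhs)) mem_tnth.
  by apply: ereal_sup_ubound; exists x.
rewrite -lee_fin fineK// fin_numE -ltey sfin andbT gt_eqF//.
exact: lt_le_trans (ltNyr _) le_sup.
Qed.

(** Homogeneity reduces this to directions of norm at most 1, with [0 = 0 *: 0] covering the
    case of a zero direction. *)
Lemma dirD_le F k u h x : Ck k.+1 F -> (supD k.+1 F < +oo)%E ->
  `|dirD ('D_h F) (nseq k u) x| <= fine (supD k.+1 F) * `|h| * `|u| ^+ k.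
Proof.
move=> CF sfin.
have unitE (v : V) : exists2 v', v = `|v| *: v' & `|v'| <= 1.
  have [->|v0] := eqVneq v 0; first by exists 0; rewrite ?scaler0 ?normr0.
  exists (`|v|^-1 *: v); first by rewrite scalerA divff ?scale1r ?normr_eq0.
  by rewrite normrZ normfV normr_id mulVf ?normr_eq0.
have [h' {1}-> h1] := unitE h; have [u' {1}-> u1] := unitE u.
rewrite -[dirD _ _ _]/(dirD F (_ :: _) x) dirD_headZ ?size_nseq//=.
rewrite dirD_nseqZ; last by case: CF => _; apply.
rewrite !normrM normrX !normr_id mulrA -[leRHS]mulrA mulrC.
rewrite ler_wpM2r ?mulr_ge0 ?exprn_ge0//.
rewrite -[dirD _ _ _]/(dirD F (h' :: nseq k u') x); apply: dirD_le_supD => //=.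
  by rewrite size_nseq.
by move=> v; rewrite inE => /predU1P[->//|/nseqP[-> _]].
Qed.

Lemma supD_ge0 F k (x : V) : (supD k F < +oo)%E -> 0 <= fine (supD k F).
Proof.
move=> sfin; apply: le_trans (normr_ge0 _) (dirD_le_supD k F (nseq k 0) x _ sfin _).
  by rewrite size_nseq.
by move=> h /nseqP[-> _]; rewrite normr0.
Qed.

(** In each direction [h] the error is the remainder of order [p] of the one-variable function
    [t |-> 'D_h F (x + t *: (y - x))] at [t = 1], whose [p]-th derivative is a derivative of
    [F] of order [p.+1]. *)
Lemma dual_norm_grad_taylor_error F p x y : Ck p.+1 F -> (supD p.+1 F < +oo)%E ->
  dual_norm (grad F y - grad (taylor F x p) y)
    <= fine (supD p.+1 F) / p`!%:R * `|y - x| ^+ p.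
Proof.
move=> CF sfin; have L0 := supD_ge0 F _ x sfin.
apply: dual_norm_le => [|h]; first by rewrite mulr_ge0 ?exprn_ge0 ?divr_ge0.
have [dF DF] := CF.
rewrite add_lfunE opp_lfunE gradE// grad_taylorE; last exact: CkS.
set u := y - x.
pose phi j (t : R) := dirD ('D_h F) (nseq j u) (x + t *: u).
have dphi j t : (j < p)%N -> is_derive t (1 : R) (phi j) (phi j.+1 t).
  move=> jp.
  have dirDS : dirD ('D_h F) (nseq j.+1 u) = 'D_u (dirD ('D_h F) (nseq j u)).
    by rewrite -dirD_rcons; congr (dirD _ _); elim: (j) => //= n ->.
  rewrite /phi dirDS; apply: is_derive_along_line => z.
  apply: (@Ck_derivable 0); apply: Ck_dirD.
  by rewrite size_nseq addn1; apply: Ck_le (DF h).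
have phip t : 0 <= t <= 1 -> `|phi p t| <= fine (supD p.+1 F) * `|h| * `|u| ^+ p.
  by move=> _; exact: dirD_le.
have xu : x + u = y by rewrite addrC subrK.
have x0u : x + 0 *: u = x by rewrite scale0r addr0.
have := taylor_remainder_le _ p phi dphi phip 1; rewrite lexx ler01 => /(_ isT).
rewrite /phi scale1r xu x0u expr1n mulr1 => /(le_trans (ler_norm _)).
under eq_bigr do rewrite expr1n mulr1.
move=> /le_trans; apply; rewrite [leRHS]mulrAC -[leRHS]mulrA [leRHS]mulrC.
move: (fine _) (`|h|) (_ ^+ _) (_^-1) => a b c d.
by rewrite le_eqVlt; apply/predU1P; left; ring.
Qed.
End Euclid.

(** * The inequality *)

(** Here [N] is the norm of [T - x] to the power [p], divided by the factorial of [p], so that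
    [M * N] and [L * N] measure the regularizing term and the Taylor error. The inexactness
    condition, which bounds [dn] by a multiple of [d <= dn + M * N], gives
    [dn <= gamma * M * N]; then [an <= (L + gamma * M) * N], and [M * N <= an + a] turns this
    into the bound [((1 - gamma) * M - L) * N <= a], which eliminates [N]. *)
Lemma inexact_step_arith (R : realFieldType) (L M gamma N d dn a an : R) :
  0 <= L -> 0 <= gamma -> 0 < M -> L < (1 - gamma) * M ->
  dn <= gamma / (1 + gamma) * d -> d <= dn + M * N ->
  an <= dn + L * N -> M * N <= an + a ->
  an <= (L + gamma * M) / ((1 - gamma) * M - L) * a.
Proof.
move=> L0 gamma0 M0 gap dn_d d_le an_le n_le.
have dn_le : dn <= gamma * M * N.
  have : (1 + gamma) * dn <= gamma * d.
    by rewrite mulrC -ler_pdivlMr ?ltr_wpDr// mulrAC.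
  have := ler_wpM2l gamma0 d_le; lra.
have gap0 : 0 < (1 - gamma) * M - L by rewrite subr_gt0.
have N_le : N <= a / ((1 - gamma) * M - L) by rewrite ler_pdivlMr//; lra.
apply: (@le_trans _ _ ((L + gamma * M) * N)); first by lra.
by rewrite mulrAC -mulrA ler_wpM2l// addr_ge0// mulr_ge0// ltW.
Qed.

Theorem lemma2p3 (R : realType) (E : vectType R) (B : spdOp E)
    (f : euclid B -> R) (psi : euclid B -> \bar R)
    (p : nat) (beta gamma M : R)
    (x T : euclid B) (g : 'Hom(euclid B, R^o)) :
  (1 <= p)%N ->
  convex_function [set: euclid B] f ->
  Ck p.+1 f ->
  (supD p.+1 f < +oo)%E ->
  proper_closed_convex psi ->
  0 <= beta < 1 ->
  0 <= gamma < beta / (1 + beta) ->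
  0 < M ->
  (1 - gamma) * M > fine (supD p.+1 f) ->
  dom psi T ->
  subdifferential psi T g ->
  dual_norm (grad (aug_taylor M f x p) T + g)
    <= gamma / (1 + gamma) * dual_norm (grad (taylor f x p) T + g) ->
  dual_norm (grad f T + (M / p`!%:R) *: grad (dpow p.+1) (T - x) + g)
    <= (fine (supD p.+1 f) + gamma * M)
         / ((1 - gamma) * M - fine (supD p.+1 f))
       * dual_norm (grad f T + g).
Proof.
case: p => [//|q] _ _ Cf sfin _ _ /andP[gamma0 _] M0 gap _ _.
rewrite grad_aug_taylor; last exact: CkS.
set Df := grad f T; set Dt := grad (taylor _ _ _) _.
set n := _ *: grad (dpow _) _; set N := `|T - x| ^+ q.+1 / q.+1`!%:R.
rewrite (addrAC Dt n g) (addrAC Df n g) => inexact.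
have n_norm : dual_norm n = M * N.
  rewrite dual_normZ dual_norm_grad_dpow ger0_norm ?divr_ge0 ?(ltW M0)//.
  by rewrite mulrAC mulrA.
have err : dual_norm (Df - Dt) <= fine (supD q.+2 f) * N.
  by rewrite mulrA mulrAC; exact: dual_norm_grad_taylor_error.
apply: (@inexact_step_arith _ _ M gamma N (dual_norm (Dt + g))
  (dual_norm (Dt + g + n)) _ _ _ gamma0 M0 gap inexact).
- exact: supD_ge0 x sfin.
- by rewrite -n_norm; exact: dual_norm_le_addr.
- have -> : Df + g + n = (Dt + g + n) + (Df - Dt).
    by rewrite [RHS]addrC -!addrA addKr.
  by apply: le_trans (dual_normD _ _) _; exact: lerD.
- by rewrite -n_norm (addrC (Df + g) n); exact: dual_norm_le_addr.
Qed.
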